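(* Let $\mathcal{F}$ be a nonempty hereditary family of finite subsets of $\mathbb{N}$. The following are equivalent: (i) $\mathcal{F}$ is closed. (ii) There does not exist an infinite sequence $(s_i)_{i=1}^{\infty}$ of elements of $\mathcal{F}$ with $s_1\prec s_2\prec\cdots$. (iii) There does not exist an infinite subset $M$ of $\mathbb{N}$ such that $[M]^{<\omega}\subseteq\mathcal{F}$.
   Context: A family is hereditary if it contains every subset of each of its elements. Subsets of $\mathbb{N}$ are identified with their characteristic functions, the set of all subsets of $\mathbb{N}$ carries the topology of pointwise convergence, and closed means closed in this space. $s\prec t$ means that $s$ is a proper initial segment of $t$. $[M]^{<\omega}$ is the set of all finite subsets of $M$. *)

(* Defs.v *)
From mathcomp Require Import all_boot all_order all_algebra.
From mathcomp Require Import all_classical all_reals all_analysis.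

Set Implicit Arguments.
Unset Strict Implicit.
Unset Printing Implicit Defensive.

Local Open Scope classical_set_scope.

Definition hereditary (F : set (set nat)) : Prop :=
  forall s t : set nat, F s -> t `<=` s -> F t.

(* [bool] carries the discrete topology, so [{ptws nat -> bool}] is the space
   of characteristic functions with the topology of pointwise convergence. *)
Definition charfun (A : set nat) : {ptws nat -> bool} := fun n => n \in A.

(* The identification of a set with its characteristic function is made
   explicit: topological notions are applied to the image under [charfun]. *)
Definition closed_family (F : set (set nat)) : Prop :=
  closed (charfun @` F).

Definition initial_segment (s t : set nat) : Prop :=
  s `<=` t /\ forall m n : nat, s m -> t n -> n <= m -> s n.

Definition proper_initial_segment (s t : set nat) : Prop :=
  initial_segment s t /\ s <> t.

Definition finite_subsets (M : set nat) : set (set nat) :=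
  [set s | finite_set s /\ s `<=` M].

(* Main.v *)
Require Import Defs.
From mathcomp Require Import all_boot all_order all_algebra.
From mathcomp Require Import all_classical all_reals all_analysis.

Local Open Scope classical_set_scope.

(** The property that links the three conditions is finite character:
    [A] belongs to [F] as soon as all its finite subsets do.  For a hereditary
    family this is what closedness means, because a set [A] is a pointwise
    limit of elements of [F] exactly when all its finite subsets are in [F]: a
    set of [F] that agrees with [A] on a finite [t `<=` A] contains [t], and
    conversely [A] is the limit of its truncations [A `&` `I_n].  This is
    [closed_familyP].

    Since [F] has only finite members, finite character just forbids an
    infinite [M] all of whose finite subsets are in [F]: such an [M] would have
    to be in [F], whereas a finite [A] is a finite subset of itself
    ([closed_family_no_infinite]).  Finally,
    truncating such an [M] at its successive elements gives a strictly growing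
    chain of initial segments, and the union of a chain in [F] is such an [M],
    because each of its finite subsets lies in a single member of the chain
    ([chainP]). *)

Lemma charfun_pred (f : {ptws nat -> bool}) : charfun [set n | f n] = f.
Proof. by apply/funext => n; exact: asboolb. Qed.

Lemma charfunK (A : set nat) : [set n | charfun A n] = A.
Proof. by apply/funext => n; exact: in_setE. Qed.

Lemma charfun_inj : injective charfun.
Proof.
move=> A B /(congr1 (fun f : nat -> bool => [set n | f n])).
by rewrite !charfunK.
Qed.

(** Evaluation at a point is continuous and singletons of [bool] are open, so
    finitely many prescribed values define a neighbourhood. *)
Lemma nbhs_ptws_agree (T : eqType) (f : {ptws T -> bool}) (r : seq T) :
  nbhs f [set g : {ptws T -> bool} | {in r, forall x, g x = f x}].
Proof.
elim: r => [|x r IHr]; first by apply: filterS filterT => g _ y.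
have nbhs_x : nbhs f [set g : {ptws T -> bool} | g x = f x].
  exact: (@proj_continuous T (fun=> bool) x f _ (discrete_set1 (f x))).
apply: filterS (filterI nbhs_x IHr) => g [gx gr] y.
by rewrite inE => /predU1P[-> //|/gr].
Qed.

Lemma cvg_charfun_truncation (A : set nat) :
  (fun n => charfun (A `&` `I_n)) @ \oo --> charfun A.
Proof.
apply/pointwise_cvgP => k; apply: cvg_near_cst.
exists k.+1 => // n /= lt_kn.
by rewrite /charfun in_setI (mem_set (lt_kn : `I_n k)) andbT.
Qed.

Lemma closed_familyP (F : set (set nat)) : hereditary F ->
  closed_family F <-> forall A : set nat, finite_subsets A `<=` F -> F A.
Proof.
move=> F_hereditary; split=> [F_closed A subA|F_fin f f_closure].
  have : (charfun @` F) (charfun A).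
    apply: (@closed_cvg _ _ \oo _ (fun n => charfun (A `&` `I_n))
              (charfun @` F) F_closed _ _ (cvg_charfun_truncation A)).
    near=> n; exists (A `&` `I_n) => //; apply: subA; split.
      exact: finite_setIr (finite_II n).
    exact: subIsetl.
  by case=> B FB /charfun_inj <-.
exists [set n | f n]; last exact: charfun_pred.
apply: F_fin => t [/finite_seqP[r ->] sub_rf].
(* [r] lists elements of [[set n | f n]], so a member of [F] that agrees with
   [f] on [r] contains [r], and heredity applies. *)
have [g [[B FB <-] eq_r]] := f_closure _ (nbhs_ptws_agree _ f r).
apply: F_hereditary FB _ => n /= rn.
by apply: set_mem; rewrite -/(charfun B n) eq_r //; exact: sub_rf.
Unshelve. all: by end_near.
Qed.

Lemma closed_family_no_infinite (F : set (set nat)) :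
    (forall s, F s -> finite_set s) -> hereditary F ->
  closed_family F <->
  ~ exists M : set nat, infinite_set M /\ finite_subsets M `<=` F.
Proof.
move=> F_finite F_hereditary; split.
  move=> /(closed_familyP F F_hereditary) F_fin.
  by case=> [M [M_inf /F_fin/F_finite/M_inf]].
move=> no_M; apply/(closed_familyP F F_hereditary) => A subA.
apply: (subA); split=> //.
by apply: contrapT => A_inf; apply: no_M; exists A.
Qed.

Lemma finite_subset_chain (T : Type) (s : nat -> set T) (t : set T) :
    (forall i, s i `<=` s i.+1) -> finite_set t -> t `<=` \bigcup_i s i ->
  exists i, t `<=` s i.
Proof.
elim/Pchoice: T => T in s t * => s_incr.
have s_mono i j : i <= j -> s i `<=` s j.
  move=> /subnK <-; elim: (j - i) => [|k IHk] //.
  exact: subset_trans IHk (s_incr _).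
case/finite_seqP=> r ->; elim: r => [|x r IHr] sub_r; first by exists 0.
have [|i sub_ri] := IHr.
  by move=> y ry; apply: sub_r; rewrite /= inE ry orbT.
have [|j _ sjx] := sub_r x; first by rewrite /= inE eqxx.
exists (maxn i j) => y; rewrite /= inE => /predU1P[->|ry].
  exact: s_mono (leq_maxr i j) _ sjx.
exact: s_mono (leq_maxl i j) _ (sub_ri _ ry).
Qed.

Lemma truncation_proper (M : set nat) (a b m : nat) :
  M m -> a <= m < b -> proper_initial_segment (M `&` `I_a) (M `&` `I_b).
Proof.
move=> Mm /andP[le_am lt_mb]; split; last first.
  move=> eq_ab; have : (M `&` `I_b) m by [].
  by rewrite -eq_ab => -[_]; rewrite /= ltnNge le_am.
split=> [n [Mn /= lt_na]|n k [_ /= lt_na] [Mk _] le_kn].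
  by split=> //=; apply: ltn_trans lt_na (leq_ltn_trans le_am lt_mb).
by split=> //=; apply: leq_ltn_trans le_kn lt_na.
Qed.

Lemma chainP (F : set (set nat)) : hereditary F ->
  (exists s : nat -> set nat,
     (forall i, F (s i)) /\
     (forall i, proper_initial_segment (s i) (s i.+1))) <->
  exists M : set nat, infinite_set M /\ finite_subsets M `<=` F.
Proof.
move=> F_hereditary; split=> [[s [Fs s_chain]]|[M [M_inf subM]]].
  have s_incr i : s i `<=` s i.+1 by case: (s_chain i) => -[].
  have in_chain t : finite_set t -> t `<=` \bigcup_i s i ->
    exists i, t `<=` s i by exact: finite_subset_chain s_incr.
  exists (\bigcup_i s i); split=> [M_fin|t [t_fin /(in_chain _ t_fin)[i]]].
    (* A finite union would already be exhausted by some [s i]. *)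
    have [i sub_i] := in_chain _ M_fin (@subset_refl _ _).
    case: (s_chain i) => _; apply; apply/seteqP; split=> //.
    by apply: subset_trans sub_i; exact: bigcup_sup.
  exact: F_hereditary.
have [n|f [f_incr _ Mf]] := infinite_increasing_seq_wf _ M_inf 0%N.
  by apply: sub_finite_set (finite_II n.+1) => k.
(* The cut points lie in [M], so [f i] belongs to the truncation of index
   [i.+1] but not to that of index [i]. *)
exists (fun i => M `&` `I_(f i)); split=> i.
  apply: subM; split; last exact: subIsetl.
  exact: finite_setIr (finite_II _).
apply: (truncation_proper _ _ _ _ (Mf i)); rewrite leqnn /=.
by move/increasing_seqP : f_incr; apply.
Qed.

Theorem proposition2p14 (F : set (set nat))
    (F_finite : forall s : set nat, F s -> finite_set s)
    (F_nonempty : F !=set0)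
    (F_hereditary : hereditary F) :
  (closed_family F <->
   ~ exists s : nat -> set nat,
       (forall i, F (s i)) /\
       (forall i, proper_initial_segment (s i) (s i.+1))) /\
  ((~ exists s : nat -> set nat,
       (forall i, F (s i)) /\
       (forall i, proper_initial_segment (s i) (s i.+1))) <->
   ~ exists M : set nat, infinite_set M /\ finite_subsets M `<=` F).
Proof.
have chain_M := not_iff_compat (chainP F F_hereditary); split=> //.
exact: iff_trans (closed_family_no_infinite F F_finite F_hereditary)
                 (iff_sym chain_M).
Qed.
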